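(* The following identity holds: $$\int_{0}^{\infty}\frac{\operatorname{Im}\!\left(\beta\!\left(\frac12+iv\right)\right)}{\cosh(\pi v)}\,v\,dv=\frac{\pi^{2}}{48}-\frac{\ln 2}{4}.$$
   Context: $\beta(s)=2^{-s}\sum_{k=0}^{\infty}(-1)^k/(k+\frac12)^s=\sum_{k=0}^{\infty}(-1)^k/(2k+1)^s$ for $\Re(s)>0$ is Dirichlet's beta function. *)

(* Defs.v *)
From Stdlib Require Import Reals Lra.
From Coquelicot Require Import Coquelicot.
Open Scope R_scope.

Definition Cexp (z : C) : C := (exp (Re z) * cos (Im z), exp (Re z) * sin (Im z)).

(* Principal power x^s of a positive real x; not meaningful for x <= 0. *)
Definition Rcpow (x : R) (s : C) : C := Cexp (Cmult s (RtoC (ln x))).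

(* Sum of a complex series, as a total function in the style of [Series]:
   unspecified on divergent series, see [CSeries_unique]. *)
Definition CSeries (a : nat -> C) : C :=
  (Series (fun k => Re (a k)), Series (fun k => Im (a k))).

Lemma CSeries_unique (a : nat -> C) (l : C) :
  is_series (V := C_NormedModule) a l -> CSeries a = l.
Proof.
intros H.
assert (HS : forall n, sum_n (G := C_AbelianMonoid) a n
  = (sum_n (fun k => Re (a k)) n, sum_n (fun k => Im (a k)) n)).
{ induction n as [|n IH].
  - rewrite !sum_O. now destruct (a 0%nat).
  - rewrite !sum_Sn, IH. reflexivity. }
assert (HB : forall eps : posreal, exists N, forall n, (N <= n)%nat ->
  Rabs (sum_n (fun k => Re (a k)) n - Re l) < eps /\
  Rabs (sum_n (fun k => Im (a k)) n - Im l) < eps).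
{ intros eps.
  assert (HP : locally (T := C_UniformSpace) l
    (fun z : C => Rabs (Re z - Re l) < eps /\ Rabs (Im z - Im l) < eps)).
  { exists eps. intros y [H1 H2]. split; [exact H1 | exact H2]. }
  destruct (H _ HP) as [N HN]. exists N. intros n Hn.
  specialize (HN n Hn). rewrite HS in HN. exact HN. }
destruct l as [x y]. unfold CSeries. f_equal; apply is_series_unique;
  apply (proj2 (filterlim_locally _ _)); intros eps;
  destruct (HB eps) as [N HN]; exists N; intros n Hn; apply (HN n Hn).
Qed.

(* The series converges (conditionally when Re s <= 1) for 0 < Re s, which is
   where this is Dirichlet's beta function. *)
Definition Dirichlet_beta (s : C) : C :=
  CSeries (fun k : nat => Cdiv (Cpow (RtoC (-1)) k) (Rcpow (2 * INR k + 1) s)).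

(* Main.v *)
Require Import Defs.
From Stdlib Require Import Reals Lra Lia.
From Coquelicot Require Import Coquelicot.
Open Scope R_scope.

(** Since [1 / cosh (PI v) = 2 * sum_j (-1)^j exp (- (2 j + 1) PI v)], the integral of
    [v sin (a v) / cosh (PI v)] over [(0, oo)] is a partial fraction series in [a]. Its sum
    [sinh (a / 2) / (4 cosh (a / 2)^2)] is found by localizing cosine coefficients on
    [[0, PI/2]] with the Dirichlet kernel. At [a = ln (2 k + 1)], weighted by
    [- (-1)^k (2 k + 1)^(-1/2)], it equals [- (-1)^k k / (4 (k + 1)^2)], so that the integral
    is [(eta(2) - ln 2) / 4], and [eta(2) = PI^2 / 12] comes from the same kernel argument
    applied to [x^2].

    Sum and integral are exchanged although the beta series converges only conditionally:
    its alternating remainder after [2 n + 1] terms is [O ((1 + |v|) / sqrt n)], which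
    [1 / cosh (PI v)] makes integrable in [v], uniformly in [n]. *)

(** * Improper integrals over [[0, oo)] and limits under an exponential bound *)

Lemma exp_le (x y : R) : x <= y -> exp x <= exp y.
Proof.
intros [H| ->]; [left; now apply exp_increasing|right; reflexivity].
Qed.

Lemma is_RInt_gen_0_infty_spec (f : R -> R) (l : R) :
  is_RInt_gen f (at_point 0) (Rbar_locally p_infty) l <->
  forall eps : posreal, exists B : R, 0 <= B /\
    forall b : R, B < b -> exists y : R, is_RInt f 0 b y /\ Rabs (y - l) < eps.
Proof.
split.
- intros H eps.
  assert (HP : locally l (fun y : R => Rabs (y - l) < eps)).
  { exists eps. intros y Hy. exact Hy. }
  destruct (H _ HP) as [Q T HQ [M HM] Hall].
  exists (Rmax 0 M). split; [apply Rmax_l|]. intros b Hb.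
  destruct (Hall 0 b HQ (HM b (Rle_lt_trans _ _ _ (Rmax_r 0 M) Hb))) as [y [Hy1 Hy2]].
  now exists y.
- intros H P [eps HP].
  destruct (H eps) as [B [HB0 HB]].
  exists (fun x => x = 0) (fun x => B < x).
  + reflexivity.
  + now exists B.
  + intros x y -> Hy. destruct (HB y Hy) as [z [Hz1 Hz2]].
    exists z. split; [exact Hz1|]. now apply HP.
Qed.

Lemma is_RInt_exp_opp (b : R) : is_RInt (fun x => exp (- x)) 0 b (1 - exp (- b)).
Proof.
replace (1 - exp (- b)) with (minus (- exp (- b)) (- exp (- 0)))
  by (rewrite Ropp_0, exp_0; unfold minus, plus, opp; simpl; ring).
apply (is_RInt_derive (fun x => - exp (- x))).
- intros x _. auto_derive; [trivial|ring].
- intros x _. apply (ex_derive_continuous (fun x => exp (- x))). now auto_derive.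
Qed.

(** The bound [eps n * exp (- x)] does double duty. It makes [hn] converge uniformly on [[0, b]], so
    that [h] inherits integrability there from its approximants, and, integrated, it keeps the error
    below [eps n] for every [b], so that the limits in [n] and [b] may be exchanged. *)
Lemma is_RInt_gen_exp_dominated_lim (h : R -> R) (hn : nat -> R -> R)
  (c eps : nat -> R) (l : R) :
  (forall n x, continuous (hn n) x) ->
  (forall n x, 0 <= x -> Rabs (h x - hn n x) <= eps n * exp (- x)) ->
  is_lim_seq eps 0 ->
  (forall n, is_RInt_gen (hn n) (at_point 0) (Rbar_locally p_infty) (c n)) ->
  is_lim_seq c l ->
  is_RInt_gen h (at_point 0) (Rbar_locally p_infty) l.
Proof.
intros Hc Hd He Hi Hl.
assert (Heps : forall n, 0 <= eps n).
{ intros n. pose proof (Hd n 0 (Rle_refl 0)) as H.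
  rewrite Ropp_0, exp_0, Rmult_1_r in H.
  pose proof (Rabs_pos (h 0 - hn n 0)). lra. }
assert (Hex : forall b, 0 <= b -> ex_RInt h 0 b).
{ intros b Hb.
  (* [filterlim_RInt] asks for uniform convergence on the whole line, while the domination holds on
     the half-line only; composing with [Rabs] extends it evenly without changing anything on
     [[0, b]]. *)
  destruct (filterlim_RInt (fun n x => hn n (Rabs x)) 0 b eventually _
    (fun x => h (Rabs x)) (fun n => RInt (fun x => hn n (Rabs x)) 0 b)) as [If [_ HI]].
  - intros n. apply (RInt_correct (V := R_CompleteNormedModule)).
    apply (ex_RInt_continuous (V := R_CompleteNormedModule)). intros z _.
    apply (continuous_comp Rabs (hn n)); [apply continuous_Rabs|apply Hc].
  - apply (proj2 (filterlim_locally _ _)). intros e.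
    apply is_lim_seq_spec in He. destruct (He e) as [N HN].
    exists N. intros n Hn x. specialize (HN n Hn).
    change (Rabs (hn n (Rabs x) - h (Rabs x)) < e).
    rewrite Rabs_minus_sym.
    apply Rle_lt_trans with (1 := Hd n (Rabs x) (Rabs_pos x)).
    rewrite Rminus_0_r, Rabs_pos_eq in HN by apply Heps.
    apply Rle_lt_trans with (2 := HN).
    rewrite <- (Rmult_1_r (eps n)) at 2. apply Rmult_le_compat_l; [apply Heps|].
    rewrite <- exp_0. apply exp_le. pose proof (Rabs_pos x). lra.
  - exists If. apply is_RInt_ext with (2 := HI).
    intros x Hx. rewrite Rmin_left, Rmax_right in Hx by lra.
    now rewrite Rabs_pos_eq by lra. }
apply is_RInt_gen_0_infty_spec. intros e.
(* The three thirds pay for replacing [h] by [hn n], for cutting the integral of [hn n] at [b], and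
   for replacing [c n] by [l]. *)
assert (He3 : 0 < e / 3) by (destruct e; simpl; lra).
set (e3 := mkposreal _ He3).
apply is_lim_seq_spec in He. destruct (He e3) as [N1 HN1].
apply is_lim_seq_spec in Hl. destruct (Hl e3) as [N2 HN2].
set (n := (N1 + N2)%nat).
specialize (HN1 n ltac:(unfold n; lia)). specialize (HN2 n ltac:(unfold n; lia)).
simpl in HN1, HN2.
rewrite Rminus_0_r, Rabs_pos_eq in HN1 by apply Heps.
destruct (proj1 (is_RInt_gen_0_infty_spec _ _) (Hi n) e3) as [B [HB0 HB]].
exists B. split; [exact HB0|]. intros b Hb.
destruct (HB b Hb) as [y [Hy1 Hy2]]. simpl in Hy2.
exists (RInt h 0 b).
pose proof (RInt_correct (V := R_CompleteNormedModule) h 0 b (Hex b ltac:(lra))) as Hh.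
split; [exact Hh|].
assert (Hdiff : Rabs (RInt h 0 b - y) <= eps n * (1 - exp (- b))).
{ apply (norm_RInt_le (V := R_NormedModule) (fun x => minus (h x) (hn n x))
    (fun x => eps n * exp (- x)) 0 b (RInt h 0 b - y)).
  - lra.
  - intros x Hx. apply Hd. lra.
  - exact (is_RInt_minus (V := R_NormedModule) _ _ _ _ _ _ Hh Hy1).
  - apply (is_RInt_scal (V := R_NormedModule)), is_RInt_exp_opp. }
assert (eps n * (1 - exp (- b)) <= eps n).
{ pose proof (Heps n). pose proof (exp_pos (- b)). nra. }
replace (RInt h 0 b - l) with ((RInt h 0 b - y) + (y - c n) + (c n - l)) by ring.
apply Rle_lt_trans with (1 := Rabs_triang _ _).
pose proof (Rabs_triang (RInt h 0 b - y) (y - c n)). lra.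
Qed.

(** * A quantitative Riemann-Lebesgue estimate *)

(* Integration by parts against [sin (lam x)], performed after dividing [phi] by
   [sin]; [phi 0 = 0] makes the quotient differentiable up to [0]. Near [0] the
   crude bound [Rabs (K x) <= lam] suffices on an interval of length [1 / lam]. *)
Lemma Riemann_Lebesgue_Dirichlet_kernel (phi phi1 phi2 : R -> R) :
  (forall x, is_derive phi x (phi1 x)) ->
  (forall x, is_derive phi1 x (phi2 x)) ->
  (forall x, continuous phi2 x) ->
  phi 0 = 0 ->
  exists M : R, forall (lam : R) (K : R -> R), 1 <= lam ->
    (forall x, continuous K x) ->
    (forall x, Rabs (K x) <= lam) ->
    (forall x, K x * sin x = sin (lam * x)) ->
    Rabs (RInt (fun x => phi x * K x) 0 (PI / 2)) <= M / lam.
Proof.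
intros D1 D2 C2 H0.
assert (C0 : forall x, continuous phi x).
{ intros x. apply (ex_derive_continuous phi). now exists (phi1 x). }
assert (C1 : forall x, continuous phi1 x).
{ intros x. apply (ex_derive_continuous phi1). now exists (phi2 x). }
pose proof PI_4 as HPI4. pose proof PI2_3_2 as HPI3.
destruct (bounded_continuity (V := R_NormedModule) phi 0 (PI / 2) (fun x _ => C0 x))
  as [B0 HB0].
destruct (bounded_continuity (V := R_NormedModule) phi1 0 (PI / 2) (fun x _ => C1 x))
  as [B1 HB1].
destruct (bounded_continuity (V := R_NormedModule) phi2 0 (PI / 2) (fun x _ => C2 x))
  as [B2 HB2].
change (forall x : R, 0 <= x <= PI / 2 -> Rabs (phi x) < B0) in HB0.
change (forall x : R, 0 <= x <= PI / 2 -> Rabs (phi1 x) < B1) in HB1.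
change (forall x : R, 0 <= x <= PI / 2 -> Rabs (phi2 x) < B2) in HB2.
set (B := B0 + B1 + B2).
assert (HB0p : 0 < B0).
{ apply Rle_lt_trans with (2 := HB0 0 ltac:(lra)). apply Rabs_pos. }
assert (HB1p : 0 < B1).
{ apply Rle_lt_trans with (2 := HB1 0 ltac:(lra)). apply Rabs_pos. }
assert (HB2p : 0 < B2).
{ apply Rle_lt_trans with (2 := HB2 0 ltac:(lra)). apply Rabs_pos. }
assert (Hphi : forall x, 0 <= x <= PI / 2 -> Rabs (phi x) <= B * x).
{ intros x Hx.
  destruct (MVT_gen phi 0 x phi1) as [z [Hz Ez]].
  - intros; apply D1.
  - intros; apply continuity_pt_filterlim, C0.
  - rewrite Rmin_left, Rmax_right in Hz by lra.
    replace (phi x) with (phi1 z * (x - 0)) by lra.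
    rewrite Rabs_mult, Rminus_0_r, (Rabs_pos_eq x) by lra.
    apply Rmult_le_compat_r; [lra|].
    pose proof (HB1 z ltac:(lra)). unfold B. lra. }
(* Here [sin x >= x - x^3 / 6], and [x <= PI / 2 <= 2] gives [x^2 / 6 <= 2 / 3]. *)
assert (Hsin : forall x, 0 <= x <= PI / 2 -> x / 3 <= sin x).
{ intros x Hx.
  destruct (sin_bound x 0) as [Hs _]; try lra.
  apply Rle_trans with (2 := Hs).
  unfold sin_approx, sin_term. simpl. nra. }
(* This is the numerator of the derivative of [phi / sin]. It vanishes at 0 and its own derivative
   [(phi2 + phi) * sin] is [O(t)], so it is of second order and compensates the [sin^2] below it. *)
assert (HD : forall x, 0 <= x <= PI / 2 ->
  Rabs (phi1 x * sin x - phi x * cos x) <= B * x ^ 2).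
{ intros x Hx.
  destruct (MVT_gen (fun t => phi1 t * sin t - phi t * cos t) 0 x
     (fun t => (phi2 t + phi t) * sin t)) as [z [Hz Ez]].
  - intros t _. auto_derive.
    + split; [now exists (phi2 t)|]. split; [now exists (phi1 t)|trivial].
    + replace (Derive (fun x => phi1 x) t) with (phi2 t) by (symmetry; apply is_derive_unique, D2).
      replace (Derive (fun x => phi x) t) with (phi1 t) by (symmetry; apply is_derive_unique, D1).
      ring.
  - intros t _. apply continuity_pt_filterlim.
    apply (ex_derive_continuous (fun t => phi1 t * sin t - phi t * cos t)).
    auto_derive. split; [now exists (phi2 t)|]. split; [now exists (phi1 t)|trivial].
  - rewrite Rmin_left, Rmax_right in Hz by lra.
    rewrite H0, sin_0 in Ez.
    replace (phi1 x * sin x - phi x * cos x) with ((phi2 z + phi z) * sin z * (x - 0)) by lra.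
    rewrite !Rabs_mult, Rminus_0_r, (Rabs_pos_eq x) by lra.
    replace (B * x ^ 2) with (B * x * x) by ring.
    apply Rmult_le_compat_r; [lra|].
    apply Rmult_le_compat; try apply Rabs_pos.
    + apply Rle_trans with (1 := Rabs_triang _ _).
      pose proof (HB2 z ltac:(lra)). pose proof (HB0 z ltac:(lra)). unfold B. lra.
    + apply Rle_trans with z; [|lra].
      rewrite Rabs_pos_eq by (apply sin_ge_0; lra).
      destruct (Rle_lt_or_eq_dec 0 z ltac:(lra)) as [Hz0|<-].
      * left. now apply sin_lt_x.
      * rewrite sin_0. lra. }
set (dpsi := fun x => (phi1 x * sin x - phi x * cos x) / (sin x) ^ 2).
(* [B] comes from [[0, d]], [6 * B] from the two boundary values of [P], and [9 * B * 2] from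
   [dpsi], bounded by [9 * B], on an interval of length at most 2. *)
exists (B + 6 * B + 9 * B * 2).
intros lam K Hlam CK HK HKs.
set (d := / lam).
assert (Hd : 0 < d <= 1).
{ split; [apply Rinv_0_lt_compat; lra|].
  unfold d. rewrite <- Rinv_1. apply Rinv_le_contravar; lra. }
assert (Hlamd : lam * d = 1) by (unfold d; field; lra).
assert (Cint : forall x, continuous (fun x => phi x * K x) x).
{ intros x. apply (continuous_mult (K := R_AbsRing) phi K); [apply C0|apply CK]. }
assert (Eint : forall a b, ex_RInt (fun x => phi x * K x) a b).
{ intros a b. apply (ex_RInt_continuous (V := R_CompleteNormedModule)). intros z _. apply Cint. }
rewrite <- (RInt_Chasles (V := R_CompleteNormedModule) (fun x => phi x * K x) 0 d (PI / 2))
  by apply Eint.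
change (Rabs (RInt (fun x => phi x * K x) 0 d + RInt (fun x => phi x * K x) d (PI / 2))
  <= (B + 6 * B + 9 * B * 2) / lam).
assert (I1 : Rabs (RInt (fun x => phi x * K x) 0 d) <= B * d).
{ apply Rle_trans with ((d - 0) * (B * d * lam)).
  - apply abs_RInt_le_const; [lra|apply Eint|].
    intros t Ht. rewrite Rabs_mult.
    apply Rmult_le_compat; try apply Rabs_pos; [|apply HK].
    apply Rle_trans with (1 := Hphi t ltac:(lra)).
    apply Rmult_le_compat_l; unfold B; lra.
  - right. replace (B * d * lam) with (B * (lam * d)) by ring. rewrite Hlamd. ring. }
(* The boundary term of the integration by parts, since [phi * K = (phi / sin) * sin (lam * x)]. *)
set (P := fun x => - (phi x / sin x) * (cos (lam * x) * d)).
assert (HP : forall x, 0 < x <= PI / 2 -> Rabs (P x) <= 3 * B * d).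
{ intros x Hx. unfold P. rewrite Rabs_mult, Rabs_Ropp.
  pose proof (Hsin x ltac:(lra)) as Hs.
  apply Rmult_le_compat; try apply Rabs_pos.
  - unfold Rdiv. rewrite Rabs_mult, Rabs_inv, (Rabs_pos_eq (sin x)) by lra.
    apply Rle_div_l; [lra|].
    apply Rle_trans with (1 := Hphi x ltac:(lra)).
    unfold B in *. nra.
  - rewrite Rabs_mult, (Rabs_pos_eq d) by lra.
    assert (Rabs (cos (lam * x)) <= 1) by (apply Rabs_le, COS_bound). nra. }
(* The integral minus the boundary term has derivative [dpsi t * cos (lam * t) / lam] in its upper
   end; the mean value theorem turns a pointwise bound on this into the bound on the difference. *)
assert (I2 : Rabs (RInt (fun x => phi x * K x) d (PI / 2) - (P (PI / 2) - P d))
  <= 9 * B * d * 2).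
{ destruct (MVT_gen (fun t => RInt (fun x => phi x * K x) d t - P t) d (PI / 2)
     (fun t => dpsi t * (cos (lam * t) * d))) as [z [Hz Ez]].
  - intros t Ht. rewrite Rmin_left, Rmax_right in Ht by lra.
    assert (Hs : 0 < sin t) by (apply sin_gt_0; lra).
    replace (dpsi t * (cos (lam * t) * d)) with
      (minus (phi t * K t) (phi t / sin t * sin (lam * t) - dpsi t * (cos (lam * t) * d))).
    + apply (is_derive_minus (K := R_AbsRing) (V := R_NormedModule)).
      * apply (is_derive_RInt (V := R_NormedModule) (fun x => phi x * K x) _ d t); [|apply Cint].
        apply filter_forall. intros b.
        apply (RInt_correct (V := R_CompleteNormedModule)), Eint.
      * unfold P. auto_derive.
        -- repeat apply conj; trivial; [now exists (phi1 t)|lra].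
        -- replace (Derive (fun x => phi x) t) with (phi1 t) by (symmetry; apply is_derive_unique, D1).
           unfold dpsi, d. field. lra.
    + unfold minus, plus, opp; simpl. rewrite <- HKs. field. lra.
  - intros t Ht. rewrite Rmin_left, Rmax_right in Ht by lra.
    assert (Hs : 0 < sin t) by (apply sin_gt_0; lra).
    apply continuity_pt_filterlim.
    apply (continuous_minus (V := R_NormedModule)).
    + apply (ex_derive_continuous (fun t => RInt (fun x => phi x * K x) d t)).
      exists (phi t * K t).
      apply (is_derive_RInt (V := R_NormedModule) (fun x => phi x * K x) _ d t); [|apply Cint].
      apply filter_forall. intros b.
      apply (RInt_correct (V := R_CompleteNormedModule)), Eint.
    + apply (ex_derive_continuous P). unfold P. auto_derive.
      repeat apply conj; trivial; [now exists (phi1 t)|lra].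
  - rewrite Rmin_left, Rmax_right in Hz by lra.
    rewrite (RInt_point (V := R_CompleteNormedModule)) in Ez.
    change (@zero R_CompleteNormedModule) with 0 in Ez.
    match goal with |- Rabs ?X <= _ =>
      replace X with (dpsi z * (cos (lam * z) * d) * (PI / 2 - d)) by lra end.
    rewrite !Rabs_mult, (Rabs_pos_eq d), (Rabs_pos_eq (PI / 2 - d)) by lra.
    assert (Hc : Rabs (cos (lam * z)) <= 1) by (apply Rabs_le, COS_bound).
    assert (Hp : Rabs (dpsi z) <= 9 * B).
    { pose proof (Hsin z ltac:(lra)) as Hs.
      unfold dpsi, Rdiv. rewrite Rabs_mult, Rabs_inv, <- RPow_abs, (Rabs_pos_eq (sin z)) by lra.
      apply Rle_div_l; [nra|].
      apply Rle_trans with (1 := HD z ltac:(lra)).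
      assert (z ^ 2 <= 9 * sin z ^ 2) by nra.
      assert (0 < B) by (unfold B; lra). nra. }
    apply Rmult_le_compat; try lra.
    + apply Rmult_le_pos; [apply Rabs_pos|]. apply Rmult_le_pos; [apply Rabs_pos|lra].
    + pose proof (Rabs_pos (dpsi z)). pose proof (Rabs_pos (cos (lam * z))).
      replace (9 * B * d) with (9 * B * (1 * d)) by ring.
      apply Rmult_le_compat; try lra; try nra. }
pose proof (HP (PI / 2) ltac:(lra)) as HP1. pose proof (HP d ltac:(lra)) as HP2.
replace ((B + 6 * B + 9 * B * 2) / lam) with (B * d + 3 * B * d + 3 * B * d + 9 * B * d * 2)
  by (unfold d; field; lra).
apply Rabs_le_between in I1. apply Rabs_le_between in I2.
apply Rabs_le_between in HP1. apply Rabs_le_between in HP2.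
apply Rabs_le. lra.
Qed.

(** * Finite sums and Dirichlet kernels *)

Lemma is_RInt_sum_f_R0 (F : nat -> R -> R) (I : nat -> R) (a b : R) (n : nat) :
  (forall k, is_RInt (F k) a b (I k)) ->
  is_RInt (fun x => sum_f_R0 (fun k => F k x) n) a b (sum_f_R0 I n).
Proof.
intros H. induction n as [|n IH]; simpl; [apply H|].
exact (is_RInt_plus (V := R_NormedModule) _ _ _ _ _ _ IH (H (S n))).
Qed.

Lemma is_RInt_gen_sum_f_R0 (F : nat -> R -> R) (I : nat -> R)
  (Fa Fb : (R -> Prop) -> Prop) {FFa : Filter Fa} {FFb : Filter Fb} (n : nat) :
  (forall k, is_RInt_gen (F k) Fa Fb (I k)) ->
  is_RInt_gen (fun x => sum_f_R0 (fun k => F k x) n) Fa Fb (sum_f_R0 I n).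
Proof.
intros H. induction n as [|n IH]; simpl; [apply H|].
exact (is_RInt_gen_plus (V := R_NormedModule) _ _ _ _ IH (H (S n))).
Qed.

Lemma continuous_sum_f_R0 (F : nat -> R -> R) (n : nat) (x : R) :
  (forall k, continuous (F k) x) ->
  continuous (fun x => sum_f_R0 (fun k => F k x) n) x.
Proof.
intros H. induction n as [|n IH]; simpl; [apply H|].
exact (continuous_plus (V := R_NormedModule) _ _ x IH (H (S n))).
Qed.

Lemma Rabs_sum_f_R0_le (u : nat -> R) (B : R) (n : nat) :
  (forall k, Rabs (u k) <= B) -> Rabs (sum_f_R0 u n) <= INR (S n) * B.
Proof.
intros H. induction n as [|n IH]; [simpl; rewrite Rmult_1_l; apply H|].
rewrite S_INR, tech5.
apply Rle_trans with (1 := Rabs_triang _ _). pose proof (H (S n)). lra.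
Qed.

(** Telescoping of [2 cos A sin x = sin (A + x) - sin (A - x)]. This puts the cosine sum in the form
    [K x * sin x = sin (lam * x)] of the Riemann-Lebesgue estimate with [lam = 2 (n + 1)]; the even
    kernel below does so with [lam = 2 n + 3]. *)
Lemma Dirichlet_kernel_odd (n : nat) (x : R) :
  2 * sum_f_R0 (fun j => cos ((2 * INR j + 1) * x)) n * sin x
  = sin (2 * INR (S n) * x).
Proof.
induction n as [|n IH].
- simpl. replace ((2 * 0 + 1) * x) with x by ring.
  replace (2 * 1 * x) with (2 * x) by ring. rewrite sin_2a. ring.
- rewrite tech5. rewrite Rmult_plus_distr_l, Rmult_plus_distr_r, IH.
  rewrite (S_INR (S n)).
  set (A := (2 * INR (S n) + 1) * x).
  replace (2 * INR (S n) * x) with (A - x) by (unfold A; ring).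
  replace (2 * (INR (S n) + 1) * x) with (A + x) by (unfold A; ring).
  rewrite sin_minus, sin_plus. ring.
Qed.

Lemma Dirichlet_kernel_even (n : nat) (x : R) :
  (1 + 2 * sum_f_R0 (fun j => cos (2 * INR (S j) * x)) n) * sin x
  = sin ((2 * INR (S n) + 1) * x).
Proof.
induction n as [|n IH].
- simpl. replace (2 * 1 * x) with (2 * x) by ring.
  replace ((2 * 1 + 1) * x) with (2 * x + x) by ring.
  rewrite sin_plus, sin_2a, cos_2a. pose proof (sin2_cos2 x) as H. unfold Rsqr in H.
  apply Rminus_diag_uniq.
  transitivity (sin x * (1 - (sin x * sin x + cos x * cos x))); [ring|rewrite H; ring].
- rewrite tech5. rewrite Rmult_plus_distr_l, <- Rplus_assoc, Rmult_plus_distr_r, IH.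
  set (A := 2 * INR (S (S n)) * x).
  replace ((2 * INR (S n) + 1) * x) with (A - x) by (unfold A; rewrite (S_INR (S n)); ring).
  replace ((2 * INR (S (S n)) + 1) * x) with (A + x) by (unfold A; ring).
  rewrite sin_minus, sin_plus. ring.
Qed.

Lemma sin_nat_PI (n : nat) : sin (INR n * PI) = 0.
Proof.
apply sin_eq_0_1. exists (Z.of_nat n). now rewrite <- INR_IZR_INZ.
Qed.

Lemma cos_nat_PI (n : nat) : cos (INR n * PI) = (-1) ^ n.
Proof.
induction n as [|n IH].
- simpl. now rewrite Rmult_0_l, cos_0.
- rewrite S_INR, Rmult_plus_distr_r, Rmult_1_l, neg_cos, IH. simpl. ring.
Qed.

(** * Odd cosine coefficients on [[0, PI/2]] and their sum *)

(** Orthogonality: for [j > 0] the product splits into frequencies [2 j] and [2 j + 2], whose sines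
    vanish at both ends. Hence every partial sum of the coefficients of [cos] is exactly
    [PI / 4]. *)
Lemma is_RInt_cos_cos_odd (j : nat) :
  is_RInt (fun x => cos x * cos ((2 * INR j + 1) * x)) 0 (PI / 2)
    (match j with O => PI / 4 | _ => 0 end).
Proof.
destruct j as [|j].
- replace (PI / 4) with (minus ((PI / 2 + sin (PI / 2) * cos (PI / 2)) / 2)
    ((0 + sin 0 * cos 0) / 2))
    by (rewrite cos_PI2, sin_0; unfold minus, plus, opp; simpl; field).
  apply (is_RInt_derive (fun x => (x + sin x * cos x) / 2)).
  + intros x _. auto_derive; [trivial|].
    replace ((2 * INR 0 + 1) * x) with x by (simpl; ring).
    pose proof (sin2_cos2 x). unfold Rsqr in *. nra.
  + intros x _. apply (ex_derive_continuous (fun x => cos x * cos ((2 * INR 0 + 1) * x))).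
    now auto_derive.
- assert (Hj : 0 < INR (S j)) by apply lt_0_INR, Nat.lt_0_succ.
  set (m := INR (S j)) in *.
  replace 0 with (minus
     (sin (2 * m * (PI / 2)) / (4 * m) + sin ((2 * m + 2) * (PI / 2)) / (4 * m + 4))
     (sin (2 * m * 0) / (4 * m) + sin ((2 * m + 2) * 0) / (4 * m + 4))) at 2.
  + apply (is_RInt_derive
      (fun x => sin (2 * m * x) / (4 * m) + sin ((2 * m + 2) * x) / (4 * m + 4))).
    * intros x _. auto_derive; [trivial|].
      set (A := (2 * m + 1) * x).
      replace (2 * m * x) with (A - x) by (unfold A; ring).
      replace ((2 * m + 2) * x) with (A + x) by (unfold A; ring).
      rewrite cos_minus, cos_plus. field. lra.
    * intros x _. apply (ex_derive_continuous (fun x => cos x * cos ((2 * m + 1) * x))).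
      now auto_derive.
  + rewrite !Rmult_0_r, sin_0.
    replace (2 * m * (PI / 2)) with (INR (S j) * PI) by (unfold m; field).
    replace ((2 * m + 2) * (PI / 2)) with (INR (S (S j)) * PI)
      by (rewrite (S_INR (S j)); unfold m; field).
    rewrite !sin_nat_PI. unfold minus, plus, opp; simpl. field. lra.
Qed.

Lemma is_lim_seq_div_S (M : R) : is_lim_seq (fun n => M / INR (S n)) 0.
Proof.
replace (Finite 0) with (Rbar_mult M (Rbar_inv p_infty)) by (simpl; f_equal; ring).
apply is_lim_seq_scal_l, is_lim_seq_inv; [|discriminate].
apply (is_lim_seq_incr_1 INR), is_lim_seq_INR.
Qed.

(* Subtracting [f 0 * cos x] rather than [f 0] makes the Dirichlet kernel
   integrals of the removed part exact. *)
Lemma odd_cosine_coefficients_sum (f f1 f2 : R -> R) (I : nat -> R) :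
  (forall x, is_derive f x (f1 x)) ->
  (forall x, is_derive f1 x (f2 x)) ->
  (forall x, continuous f2 x) ->
  (forall j, is_RInt (fun x => f x * cos ((2 * INR j + 1) * x)) 0 (PI / 2) (I j)) ->
  is_lim_seq (sum_f_R0 I) (f 0 * (PI / 4)).
Proof.
intros D1 D2 C2 HI.
destruct (Riemann_Lebesgue_Dirichlet_kernel
  (fun x => f x - f 0 * cos x) (fun x => f1 x + f 0 * sin x)
  (fun x => f2 x + f 0 * cos x)) as [M HM].
- intros x. auto_derive; [now exists (f1 x)|].
  replace (Derive (fun x => f x) x) with (f1 x) by (symmetry; apply is_derive_unique, D1).
  ring.
- intros x. auto_derive; [now exists (f2 x)|].
  replace (Derive (fun x => f1 x) x) with (f2 x) by (symmetry; apply is_derive_unique, D2).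
  ring.
- intros x. apply (continuous_plus (V := R_NormedModule) f2); [apply C2|].
  apply (ex_derive_continuous (fun x => f 0 * cos x)). now auto_derive.
- rewrite cos_0. ring.
- assert (HJ : forall n, sum_f_R0 (fun j : nat => match j with O => PI / 4 | _ => 0 end) n
    = PI / 4).
  { induction n as [|n IH]; [reflexivity|]. rewrite tech5, IH. ring. }
  apply is_lim_seq_ext with (fun n => (sum_f_R0 I n - f 0 * (PI / 4)) + f 0 * (PI / 4));
    [intros n; ring|].
  replace (Finite (f 0 * (PI / 4))) with (Rbar_plus 0 (f 0 * (PI / 4)))
    by (simpl; f_equal; ring).
  apply is_lim_seq_plus'; [|apply is_lim_seq_const].
  apply is_lim_seq_abs_0.
  (* One factor 2 of the 4 is in [lam = 2 (n + 1)], the other is the 2 in front of the cosine sum in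
     [K]. *)
  apply is_lim_seq_le_le with (u := fun _ => 0) (w := fun n => (M / 4) / INR (S n));
    [|apply is_lim_seq_const|apply is_lim_seq_div_S].
  intros n. split; [apply Rabs_pos|].
  assert (Hn : 1 <= INR (S n)) by (rewrite S_INR; pose proof (pos_INR n); lra).
  set (K := fun x => 2 * sum_f_R0 (fun j => cos ((2 * INR j + 1) * x)) n).
  assert (HK : is_RInt (fun x => (f x - f 0 * cos x) * K x) 0 (PI / 2)
    (2 * (sum_f_R0 I n - f 0 * (PI / 4)))).
  { pose proof (is_RInt_sum_f_R0 _ _ _ _ n HI) as H1.
    pose proof (is_RInt_sum_f_R0 _ _ _ _ n is_RInt_cos_cos_odd) as H2.
    rewrite HJ in H2.
    apply (is_RInt_scal (V := R_NormedModule) _ _ _ (f 0)) in H2.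
    pose proof (is_RInt_minus (V := R_NormedModule) _ _ _ _ _ _ H1 H2) as H3.
    apply (is_RInt_scal (V := R_NormedModule) _ _ _ 2) in H3.
    apply is_RInt_ext with (2 := H3). intros x _.
    unfold K, scal, minus, plus, opp; simpl. unfold mult; simpl.
    rewrite (sum_eq (fun k => f x * cos _) (fun k => cos ((2 * INR k + 1) * x) * f x))
      by (intros; ring).
    rewrite (sum_eq (fun k => cos x * cos _) (fun k => cos ((2 * INR k + 1) * x) * cos x))
      by (intros; ring).
    rewrite <- !scal_sum. ring. }
  specialize (HM (2 * INR (S n)) K ltac:(lra)).
  rewrite (is_RInt_unique _ _ _ _ HK), Rabs_mult, (Rabs_pos_eq 2) in HM by lra.
  replace (M / 4 / INR (S n)) with (M / (2 * INR (S n)) / 2) by (field; lra).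
  enough (2 * Rabs (sum_f_R0 I n - f 0 * (PI / 4)) <= M / (2 * INR (S n))) by lra.
  apply HM.
  + intros x. apply (continuous_scal_r (V := R_NormedModule) 2
      (fun x => sum_f_R0 (fun j => cos ((2 * INR j + 1) * x)) n)).
    apply (continuous_sum_f_R0 (fun j x => cos ((2 * INR j + 1) * x))). intros k.
    apply (ex_derive_continuous (fun x => cos ((2 * INR k + 1) * x))). now auto_derive.
  + intros x. unfold K. rewrite Rabs_mult, (Rabs_pos_eq 2) by lra.
    apply Rmult_le_compat_l; [lra|].
    rewrite <- (Rmult_1_r (INR (S n))). apply Rabs_sum_f_R0_le.
    intros k. apply Rabs_le, COS_bound.
  + intros x. apply Dirichlet_kernel_odd.
Qed.

(** * The alternating sums [eta(2)] and [ln 2] *)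

Lemma is_RInt_sqr_cos_even (k : nat) :
  is_RInt (fun x => x ^ 2 * cos (2 * INR (S k) * x)) 0 (PI / 2)
    (- (PI / 4) * ((-1) ^ k / INR (S k) ^ 2)).
Proof.
assert (Hm : 0 < INR (S k)) by apply lt_0_INR, Nat.lt_0_succ.
assert (Hs := sin_nat_PI (S k)). assert (Hc := cos_nat_PI (S k)).
revert Hm Hs Hc. generalize (INR (S k)). intros m Hm Hs Hc.
set (F := fun x => x ^ 2 * sin (2 * m * x) / (2 * m)
  + x * cos (2 * m * x) / (2 * m ^ 2) - sin (2 * m * x) / (4 * m ^ 3)).
replace (- (PI / 4) * ((-1) ^ k / m ^ 2)) with (minus (F (PI / 2)) (F 0)).
- apply (is_RInt_derive F).
  + intros x _. unfold F. auto_derive; [trivial|]. field. lra.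
  + intros x _. apply (ex_derive_continuous (fun x => x ^ 2 * cos (2 * m * x))).
    now auto_derive.
- unfold F. rewrite !Rmult_0_r, sin_0.
  replace (2 * m * (PI / 2)) with (m * PI) by field.
  rewrite Hs, Hc. unfold minus, plus, opp; simpl. field. lra.
Qed.

(** The function [x^2] vanishes at 0, so its integral against the even kernel tends to 0. The
    constant term of the kernel contributes [PI^3 / 24] and the cosines contribute [- PI / 2] times
    the partial sum, which forces the limit. *)
Lemma alternating_inverse_squares_lim :
  is_lim_seq (sum_f_R0 (fun k => (-1) ^ k / INR (S k) ^ 2)) (PI ^ 2 / 12).
Proof.
pose proof PI_RGT_0 as HPI.
destruct (Riemann_Lebesgue_Dirichlet_kernel
  (fun x => x ^ 2) (fun x => 2 * x) (fun _ => 2)) as [M HM].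
- intros x. auto_derive; [trivial|ring].
- intros x. auto_derive; [trivial|ring].
- intros x. apply continuous_const.
- ring.
- apply is_lim_seq_ext with (fun n => (sum_f_R0 (fun k => (-1) ^ k / INR (S k) ^ 2) n
    - PI ^ 2 / 12) + PI ^ 2 / 12); [intros n; ring|].
  replace (Finite (PI ^ 2 / 12)) with (Rbar_plus 0 (PI ^ 2 / 12)) by (simpl; f_equal; ring).
  apply is_lim_seq_plus'; [|apply is_lim_seq_const].
  apply is_lim_seq_abs_0.
  apply is_lim_seq_le_le with (u := fun _ => 0) (w := fun n => (2 / PI * Rabs M) / INR (S n));
    [|apply is_lim_seq_const|apply is_lim_seq_div_S].
  intros n. split; [apply Rabs_pos|].
  assert (Hn : 1 <= INR (S n)) by (rewrite S_INR; pose proof (pos_INR n); lra).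
  set (K := fun x => 1 + 2 * sum_f_R0 (fun j => cos (2 * INR (S j) * x)) n).
  set (s := sum_f_R0 (fun k => (-1) ^ k / INR (S k) ^ 2) n).
  assert (HK : is_RInt (fun x => x ^ 2 * K x) 0 (PI / 2) (PI ^ 3 / 24 - PI / 2 * s)).
  { pose proof (is_RInt_sum_f_R0 _ _ _ _ n is_RInt_sqr_cos_even) as H1.
    assert (H2 : is_RInt (fun x => x ^ 2) 0 (PI / 2) (PI ^ 3 / 24)).
    { replace (PI ^ 3 / 24) with (minus ((PI / 2) ^ 3 / 3) (0 ^ 3 / 3))
        by (unfold minus, plus, opp; simpl; field).
      apply (is_RInt_derive (fun x => x ^ 3 / 3)).
      - intros x _. auto_derive; [trivial|field].
      - intros x _. apply (ex_derive_continuous (fun x => x ^ 2)). now auto_derive. }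
    apply (is_RInt_scal (V := R_NormedModule) _ _ _ 2) in H1.
    pose proof (is_RInt_plus (V := R_NormedModule) _ _ _ _ _ _ H2 H1) as H3.
    replace (PI ^ 3 / 24 - PI / 2 * s) with (PI ^ 3 / 24
      + 2 * sum_f_R0 (fun k => - (PI / 4) * ((-1) ^ k / INR (S k) ^ 2)) n).
    - apply is_RInt_ext with (2 := H3). intros x _.
      change (x ^ 2 + 2 * sum_f_R0 (fun k => x ^ 2 * cos (2 * INR (S k) * x)) n
        = x ^ 2 * (1 + 2 * sum_f_R0 (fun k => cos (2 * INR (S k) * x)) n)).
      rewrite (sum_eq (fun k => x ^ 2 * _) (fun k => cos (2 * INR (S k) * x) * x ^ 2))
        by (intros; ring).
      rewrite <- scal_sum. ring.
    - rewrite (sum_eq (fun k => - (PI / 4) * _)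
        (fun k => ((-1) ^ k / INR (S k) ^ 2) * - (PI / 4))) by (intros; ring).
      rewrite <- scal_sum. fold s. field. }
  specialize (HM (2 * INR (S n) + 1) K ltac:(lra)).
  rewrite (is_RInt_unique _ _ _ _ HK) in HM.
  replace (PI ^ 3 / 24 - PI / 2 * s) with (- (PI / 2) * (s - PI ^ 2 / 12)) in HM by field.
  rewrite Rabs_mult, Rabs_Ropp, (Rabs_pos_eq (PI / 2)) in HM by lra.
  (* [Rabs M] replaces [M], whose sign is unknown, so that [1 / (2 n + 3)] can be enlarged to
     [1 / (n + 1)]. *)
  assert (HM' : PI / 2 * Rabs (s - PI ^ 2 / 12) <= Rabs M / INR (S n)).
  { apply Rle_trans with (M / (2 * INR (S n) + 1)).
    - apply HM.
      + intros x. apply (continuous_plus (V := R_NormedModule) (fun _ => 1)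
          (fun x => 2 * sum_f_R0 (fun j => cos (2 * INR (S j) * x)) n)).
        * apply continuous_const.
        * apply (continuous_scal_r (V := R_NormedModule) 2
            (fun x => sum_f_R0 (fun j => cos (2 * INR (S j) * x)) n)).
          apply (continuous_sum_f_R0 (fun j x => cos (2 * INR (S j) * x))). intros k.
          apply (ex_derive_continuous (fun x => cos (2 * INR (S k) * x))). now auto_derive.
      + intros x. unfold K. apply Rle_trans with (1 := Rabs_triang _ _).
        rewrite Rabs_R1, Rabs_mult, (Rabs_pos_eq 2) by lra.
        assert (Rabs (sum_f_R0 (fun j => cos (2 * INR (S j) * x)) n) <= INR (S n) * 1)
          by (apply Rabs_sum_f_R0_le; intros k; apply Rabs_le, COS_bound).
        lra.
      + intros x. apply Dirichlet_kernel_even.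
    - apply Rle_trans with (Rabs M / (2 * INR (S n) + 1)).
      + apply Rmult_le_compat_r; [|apply Rle_abs].
        left. apply Rinv_0_lt_compat. lra.
      + apply Rmult_le_compat_l; [apply Rabs_pos|]. apply Rinv_le_contravar; lra. }
  apply (Rmult_le_compat_l (2 / PI)) in HM'.
  + replace (2 / PI * (PI / 2 * Rabs (s - PI ^ 2 / 12))) with (Rabs (s - PI ^ 2 / 12)) in HM'
      by (field; lra).
    apply Rle_trans with (1 := HM'). right. field. lra.
  + left. apply Rdiv_lt_0_compat; lra.
Qed.

(** Integrate the finite geometric sum of [(- x)^k] over [[0, 1]]: it differs from [1 / (1 + x)] by
    at most [x^(n + 1)], whose integral is [1 / (n + 2)]. *)
Lemma alternating_harmonic_lim :
  is_lim_seq (sum_f_R0 (fun k => (-1) ^ k / INR (S k))) (ln 2).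
Proof.
apply is_lim_seq_ext with (fun n => (sum_f_R0 (fun k => (-1) ^ k / INR (S k)) n - ln 2) + ln 2);
  [intros n; ring|].
replace (Finite (ln 2)) with (Rbar_plus 0 (ln 2)) by (simpl; f_equal; ring).
apply is_lim_seq_plus'; [|apply is_lim_seq_const].
apply is_lim_seq_abs_0.
apply is_lim_seq_le_le with (u := fun _ => 0) (w := fun n => 1 / INR (S n));
  [|apply is_lim_seq_const|apply is_lim_seq_div_S].
intros n. split; [apply Rabs_pos|].
assert (Hn : 1 <= INR (S n)) by (rewrite S_INR; pose proof (pos_INR n); lra).
assert (Hpow : forall m, is_RInt (fun x => x ^ m) 0 1 (1 / INR (S m))).
{ intros m. assert (0 < INR (S m)) by apply lt_0_INR, Nat.lt_0_succ.
  replace (1 / INR (S m)) with (minus (1 ^ S m / INR (S m)) (0 ^ S m / INR (S m)))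
    by (rewrite pow1, pow_i by lia; unfold minus, plus, opp; simpl; simpl in H; field; lra).
  apply (is_RInt_derive (fun x => x ^ S m / INR (S m))).
  - intros x _. auto_derive; [trivial|]. simpl pred. simpl. simpl in H. field. lra.
  - intros x _. apply (ex_derive_continuous (fun x => x ^ m)). now auto_derive. }
assert (Hln : is_RInt (fun x => / (1 + x)) 0 1 (ln 2)).
{ replace (ln 2) with (minus (ln (1 + 1)) (ln (1 + 0)))
    by (rewrite Rplus_0_r, ln_1; unfold minus, plus, opp; simpl;
        replace (1 + 1) with 2 by ring; ring).
  apply (is_RInt_derive (fun x => ln (1 + x))); intros x Hx;
    rewrite Rmin_left, Rmax_right in Hx by lra.
  - auto_derive; [lra|]. field. lra.
  - apply (ex_derive_continuous (fun x => / (1 + x))). auto_derive. lra. }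
assert (Hsum : is_RInt (fun x => sum_f_R0 (fun k => (-1) ^ k * x ^ k) n) 0 1
  (sum_f_R0 (fun k => (-1) ^ k * (1 / INR (S k))) n)).
{ apply is_RInt_sum_f_R0. intros k.
  exact (is_RInt_scal (V := R_NormedModule) _ _ _ _ _ (Hpow k)). }
assert (Hgeo : forall x, 0 <= x -> sum_f_R0 (fun k => (-1) ^ k * x ^ k) n - / (1 + x)
  = (-1) ^ n * x ^ S n / (1 + x)).
{ intros x Hx. clear -Hx. induction n as [|n IH].
  - simpl. field. lra.
  - rewrite tech5. replace (sum_f_R0 (fun k => (-1) ^ k * x ^ k) n + (-1) ^ S n * x ^ S n - / (1 + x))
      with (sum_f_R0 (fun k => (-1) ^ k * x ^ k) n - / (1 + x) + (-1) ^ S n * x ^ S n) by ring.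
    rewrite IH. simpl. field. lra. }
rewrite (sum_eq (fun k => (-1) ^ k / INR (S k)) (fun k => (-1) ^ k * (1 / INR (S k))))
  by (intros; unfold Rdiv; ring).
apply Rle_trans with (1 / INR (S (S n))).
- apply (norm_RInt_le (V := R_NormedModule)
    (fun x => minus (sum_f_R0 (fun k => (-1) ^ k * x ^ k) n) (/ (1 + x)))
    (fun x => x ^ S n) 0 1 (sum_f_R0 (fun k => (-1) ^ k * (1 / INR (S k))) n - ln 2)); [lra| | |].
  + intros x Hx.
    change (Rabs (sum_f_R0 (fun k => (-1) ^ k * x ^ k) n - / (1 + x)) <= x ^ S n).
    rewrite Hgeo by lra. unfold Rdiv. rewrite !Rabs_mult, pow_1_abs, Rmult_1_l.
    pose proof (pow_le x (S n) ltac:(lra)) as Hp.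
    rewrite (Rabs_pos_eq (x ^ S n)) by exact Hp.
    rewrite <- (Rmult_1_r (x ^ S n)) at 2. apply Rmult_le_compat_l; [exact Hp|].
    rewrite Rabs_pos_eq by (left; apply Rinv_0_lt_compat; lra).
    rewrite <- Rinv_1 at 2. apply Rinv_le_contravar; lra.
  + exact (is_RInt_minus (V := R_NormedModule) _ _ _ _ _ _ Hsum Hln).
  + apply Hpow.
- apply Rmult_le_compat_l; [lra|]. apply Rinv_le_contravar; [lra|].
  rewrite (S_INR (S n)). lra.
Qed.

(** * The Laplace transform of [v sin (a v)] *)

Lemma id_mul_exp_opp_le (c v : R) : 0 < c -> v * exp (- (c * v)) <= / c.
Proof.
intros Hc.
assert (H : c * v * exp (- (c * v)) <= 1).
{ pose proof (exp_pos (- (c * v))) as Hp.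
  pose proof (exp_ineq1_le (c * v)) as H1.
  assert (E : exp (c * v) * exp (- (c * v)) = 1)
    by (rewrite <- exp_plus, Rplus_opp_r; apply exp_0).
  nra. }
apply (Rmult_le_reg_l c); [exact Hc|]. rewrite Rinv_r by lra. lra.
Qed.

(** The value is minus the [c]-derivative of [a / (a^2 + c^2)], the Laplace transform of
    [sin (a v)]. It is obtained from an explicit antiderivative that decays at infinity. *)
Lemma is_RInt_gen_id_sin_exp (a c : R) : 0 < c ->
  is_RInt_gen (fun v => v * sin (a * v) * exp (- (c * v)))
    (at_point 0) (Rbar_locally p_infty) (2 * a * c / (a ^ 2 + c ^ 2) ^ 2).
Proof.
intros Hc.
set (d := a ^ 2 + c ^ 2).
assert (Hd : 0 < d) by (unfold d; nra).
assert (Hd2 : 0 < d ^ 2) by now apply pow_lt.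
(* The imaginary part of [exp (z v) (v / z - 1 / z^2)] with [z = - c + i a]. *)
set (P := fun v => - (exp (- (c * v)) * (v * ((c * sin (a * v) + a * cos (a * v)) / d)
  - ((a ^ 2 - c ^ 2) * sin (a * v) - 2 * a * c * cos (a * v)) / d ^ 2))).
set (M1 := (c + Rabs a) / d).
set (M2 := (Rabs (a ^ 2 - c ^ 2) + Rabs (2 * a * c)) / d ^ 2).
assert (HM1 : 0 <= M1).
{ apply Rmult_le_pos; [pose proof (Rabs_pos a); lra|left; now apply Rinv_0_lt_compat]. }
assert (HM2 : 0 <= M2).
{ apply Rmult_le_pos; [|left; now apply Rinv_0_lt_compat].
  pose proof (Rabs_pos (a ^ 2 - c ^ 2)). pose proof (Rabs_pos (2 * a * c)). lra. }
assert (Hs : forall x, Rabs (sin x) <= 1) by (intros; apply Rabs_le, SIN_bound).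
assert (Hk : forall x, Rabs (cos x) <= 1) by (intros; apply Rabs_le, COS_bound).
assert (Hlin : forall p q x, Rabs (p * sin x + q * cos x) <= Rabs p + Rabs q).
{ intros p q x. apply Rle_trans with (1 := Rabs_triang _ _). rewrite !Rabs_mult.
  pose proof (Hs x). pose proof (Hk x). pose proof (Rabs_pos p). pose proof (Rabs_pos q). nra. }
(* With [exp (- c v) = e * e] and [e = exp (- c v / 2)], each [e] absorbs one factor [v] through
   [v * e <= 2 / c]; this bounds [v * Rabs (P v)] by [Q]. *)
set (Q := (M1 * (2 / c) + M2) * (2 / c)).
assert (H2c : 0 < 2 / c) by (apply Rdiv_lt_0_compat; lra).
assert (HP : forall v, 0 < v -> Rabs (P v) <= Q / v).
{ intros v Hv.
  unfold P. rewrite Rabs_Ropp, Rabs_mult, (Rabs_pos_eq (exp _)) by (left; apply exp_pos).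
  assert (B : Rabs (v * ((c * sin (a * v) + a * cos (a * v)) / d)
    - ((a ^ 2 - c ^ 2) * sin (a * v) - 2 * a * c * cos (a * v)) / d ^ 2) <= v * M1 + M2).
  { apply Rle_trans with (1 := Rabs_triang _ _).
    rewrite Rabs_Ropp, Rabs_mult, (Rabs_pos_eq v) by lra.
    unfold Rdiv, M1, M2. rewrite !Rabs_mult, !Rabs_inv, (Rabs_pos_eq d), (Rabs_pos_eq (d ^ 2))
      by lra.
    apply Rplus_le_compat.
    - apply Rmult_le_compat_l; [lra|]. apply Rmult_le_compat_r;
        [left; now apply Rinv_0_lt_compat|].
      apply Rle_trans with (1 := Hlin c a (a * v)). rewrite (Rabs_pos_eq c); lra.
    - apply Rmult_le_compat_r; [left; now apply Rinv_0_lt_compat|].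
      pose proof (Hlin (a ^ 2 - c ^ 2) (- (2 * a * c)) (a * v)) as H.
      rewrite Rabs_Ropp in H. rewrite <- !Rabs_mult.
      replace ((a ^ 2 - c ^ 2) * sin (a * v) - 2 * a * c * cos (a * v)) with
        ((a ^ 2 - c ^ 2) * sin (a * v) + - (2 * a * c) * cos (a * v)) by ring.
      exact H. }
  set (e := exp (- (c / 2 * v))).
  assert (He : exp (- (c * v)) = e * e).
  { unfold e. rewrite <- exp_plus. f_equal. field. }
  assert (He0 : 0 < e) by apply exp_pos.
  assert (He1 : v * e <= 2 / c).
  { replace (2 / c) with (/ (c / 2)) by (field; lra). apply id_mul_exp_opp_le. lra. }
  assert (He2 : e <= 1).
  { rewrite <- exp_0. apply exp_le. nra. }
  rewrite He. apply (proj1 (Rle_div_r _ _ v Hv)). unfold Q.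
  apply Rle_trans with (e * e * (v * M1 + M2) * v).
  - apply Rmult_le_compat_r; [lra|]. apply Rmult_le_compat_l; [nra|exact B].
  - replace (e * e * (v * M1 + M2) * v) with ((M1 * (v * e) + M2 * e) * (v * e)) by ring.
    assert (0 <= v * e) by nra.
    assert (0 <= M1 * (v * e)) by now apply Rmult_le_pos.
    assert (0 <= M2 * e) by (apply Rmult_le_pos; lra).
    apply Rmult_le_compat; [lra|lra| |lra].
    apply Rplus_le_compat; [now apply Rmult_le_compat_l|nra]. }
apply is_RInt_gen_0_infty_spec. intros eps.
assert (HQ : 0 <= Q) by (unfold Q; nra).
destruct eps as [eps Heps]. change (pos (mkposreal eps Heps)) with eps.
exists (Q / eps). split; [apply Rmult_le_pos; [exact HQ|left; now apply Rinv_0_lt_compat]|].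
intros b Hb.
assert (Hb0 : 0 < b).
{ apply Rle_lt_trans with (2 := Hb).
  apply Rmult_le_pos; [exact HQ|left; now apply Rinv_0_lt_compat]. }
exists (P b - P 0). split.
- apply (is_RInt_derive P).
  + intros x _. unfold P. auto_derive; [trivial|]. unfold d. field. fold d. lra.
  + intros x _. apply (ex_derive_continuous (fun v => v * sin (a * v) * exp (- (c * v)))).
    now auto_derive.
- replace (P b - P 0 - 2 * a * c / d ^ 2) with (P b).
  + apply Rle_lt_trans with (1 := HP b Hb0).
    apply (proj2 (Rlt_div_l _ _ b Hb0)). apply (proj1 (Rlt_div_l _ _ eps Heps)) in Hb. lra.
  + enough (E : P 0 = - (2 * a * c / d ^ 2)) by (rewrite E; ring).
    unfold P. rewrite !Rmult_0_r, Ropp_0, exp_0, sin_0, cos_0. field. lra.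
Qed.

(** * Expansion of [1 / cosh (PI v)] and the partial fraction series *)

(** Multiplying by [2 cosh x] turns [exp (- (2 j + 1) x)] into
    [exp (- 2 j x) + exp (- 2 (j + 1) x)], and the alternating sum telescopes. The exact remainder
    is what the domination of the partial sums uses. *)
Lemma sech_partial_geometric_sum (x : R) (n : nat) :
  2 * sum_f_R0 (fun j => (-1) ^ j * exp (- ((2 * INR j + 1) * x))) n * cosh x
  = 1 + (-1) ^ n * exp (- (2 * INR (S n) * x)).
Proof.
unfold cosh. induction n as [|n IH].
- simpl. replace (- ((2 * 0 + 1) * x)) with (- x) by ring.
  replace (- (2 * 1 * x)) with (- x + - x) by ring.
  rewrite exp_plus.
  assert (E : exp x * exp (- x) = 1) by (rewrite <- exp_plus, Rplus_opp_r; apply exp_0).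
  lra.
- rewrite tech5, Rmult_plus_distr_l, Rmult_plus_distr_r, IH.
  replace (- (2 * INR (S (S n)) * x)) with (- ((2 * INR (S n) + 1) * x) + - x)
    by (rewrite (S_INR (S n)); ring).
  replace (- (2 * INR (S n) * x)) with (- ((2 * INR (S n) + 1) * x) + x) by ring.
  rewrite !exp_plus. simpl pow. field.
Qed.

Lemma cosh_pos (x : R) : 0 < cosh x.
Proof. unfold cosh. pose proof (exp_pos x). pose proof (exp_pos (- x)). lra. Qed.

(** The rate is lowered from [PI] to 2: one [exp (- v)] then remains for the dominated limit and the
    other can absorb polynomial growth in [v]. *)
Lemma Rinv_cosh_PI_le (v : R) : 0 <= v -> / cosh (PI * v) <= 2 * exp (- (2 * v)).
Proof.
intros Hv. pose proof PI2_3_2.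
assert (H1 : exp (2 * v) / 2 <= cosh (PI * v)).
{ unfold cosh. pose proof (exp_pos (- (PI * v))).
  pose proof (exp_le (2 * v) (PI * v) ltac:(nra)). lra. }
pose proof (exp_pos (2 * v)).
rewrite exp_Ropp. replace (2 * / exp (2 * v)) with (/ (exp (2 * v) / 2)) by (field; lra).
apply Rinv_le_contravar; lra.
Qed.

Lemma continuous_sin_div_cosh (a x : R) :
  continuous (fun v => sin (a * v) / cosh (PI * v) * v) x.
Proof.
apply (ex_derive_continuous (fun v => sin (a * v) / cosh (PI * v) * v)).
auto_derive. pose proof (cosh_pos (PI * x)). lra.
Qed.

(* The profile whose odd cosine coefficients on [0, PI/2] are, up to a constant, the
   terms of the partial fraction expansion in [al]: it is the [al]-derivative of
   [cosh (al * x) / cosh (al * (PI / 2))], whose coefficients are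
   [(-1) ^ j * m / (al ^ 2 + m ^ 2)] with [m = 2 * j + 1]. *)
Lemma sinh_cosh_partial_fractions (al : R) :
  is_lim_seq
    (sum_f_R0 (fun j => (-1) ^ j * (2 * al * (2 * INR j + 1)
       / (al ^ 2 + (2 * INR j + 1) ^ 2) ^ 2)))
    (PI ^ 2 / 8 * (sinh (al * (PI / 2)) / cosh (al * (PI / 2)) ^ 2)).
Proof.
set (c0 := cosh (al * (PI / 2))). set (s0 := sinh (al * (PI / 2))).
assert (Hc0 : 0 < c0) by apply cosh_pos.
set (f := fun x => (x * sinh (al * x) * c0 - cosh (al * x) * (PI / 2) * s0) / c0 ^ 2).
set (f1 := fun x => ((sinh (al * x) + al * x * cosh (al * x)) * c0
  - al * sinh (al * x) * (PI / 2) * s0) / c0 ^ 2).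
set (f2 := fun x => ((2 * al * cosh (al * x) + al ^ 2 * x * sinh (al * x)) * c0
  - al ^ 2 * cosh (al * x) * (PI / 2) * s0) / c0 ^ 2).
(* Both [f 0 = - (PI / 2) s0 / c0^2] and the coefficients of [f] carry a minus sign, hence the
   factor [-1] on both sides. *)
replace (PI ^ 2 / 8 * (s0 / c0 ^ 2)) with (-1 * (f 0 * (PI / 4))).
2:{ unfold f. rewrite Rmult_0_r, sinh_0, cosh_0. field. lra. }
apply is_lim_seq_ext with (fun n => -1 * sum_f_R0 (fun j => (-1) * ((-1) ^ j * (2 * al
  * (2 * INR j + 1) / (al ^ 2 + (2 * INR j + 1) ^ 2) ^ 2))) n).
{ intros n. rewrite scal_sum. apply sum_eq. intros i _. ring. }
apply (is_lim_seq_scal_l _ (-1) (Finite (f 0 * (PI / 4)))).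
apply (odd_cosine_coefficients_sum f f1 f2).
- intros x. unfold f, f1. auto_derive; [trivial|]. field. lra.
- intros x. unfold f1, f2. auto_derive; [trivial|]. field. lra.
- intros x. apply (ex_derive_continuous f2). unfold f2. now auto_derive.
- intros j.
  assert (Hm : 0 < 2 * INR j + 1) by (pose proof (pos_INR j); lra).
  assert (Hs : sin ((2 * INR j + 1) * (PI / 2)) = (-1) ^ j).
  { replace ((2 * INR j + 1) * (PI / 2)) with (PI / 2 + INR j * PI) by field.
    rewrite <- cos_sin. apply cos_nat_PI. }
  assert (Hc : cos ((2 * INR j + 1) * (PI / 2)) = 0).
  { replace ((2 * INR j + 1) * (PI / 2)) with (INR j * PI + PI / 2) by field.
    rewrite cos_plus, cos_PI2, sin_nat_PI. ring. }
  revert Hm Hs Hc. generalize (2 * INR j + 1). intros m Hm Hs Hc.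
  set (q := al ^ 2 + m ^ 2).
  assert (Hq : 0 < q) by (unfold q; nra).
  (* The bracket after [PI / 2 * s0], over [q], is the primitive of [cosh (al x) cos (m x)]; the
     bracket after [c0] is its [al]-derivative, the primitive of [x sinh (al x) cos (m x)]. *)
  set (F := fun x =>
    (c0 * ((m * x * sinh (al * x) * sin (m * x) + sinh (al * x) * cos (m * x)
         + al * x * cosh (al * x) * cos (m * x)) / q
       - 2 * al * (m * cosh (al * x) * sin (m * x) + al * sinh (al * x) * cos (m * x)) / q ^ 2)
     - PI / 2 * s0 * (m * cosh (al * x) * sin (m * x) + al * sinh (al * x) * cos (m * x)) / q)
    / c0 ^ 2).
  replace (-1 * ((-1) ^ j * (2 * al * m / q ^ 2))) with (minus (F (PI / 2)) (F 0)).
  + apply (is_RInt_derive F).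
    * intros x _. unfold F, f. auto_derive; [trivial|]. unfold q. field. fold q. lra.
    * intros x _. apply (ex_derive_continuous (fun x => f x * cos (m * x))).
      unfold f. now auto_derive.
  + unfold F. rewrite !Rmult_0_r, sin_0, sinh_0, Hs, Hc. fold c0 s0.
    unfold minus, plus, opp; simpl. field. lra.
Qed.

Lemma is_RInt_gen_id_sin_sech (a : R) :
  is_RInt_gen (fun v => sin (a * v) / cosh (PI * v) * v)
    (at_point 0) (Rbar_locally p_infty) (sinh (a / 2) / (4 * cosh (a / 2) ^ 2)).
Proof.
pose proof PI2_3_2 as HPI.
apply (is_RInt_gen_exp_dominated_lim _
  (fun n v => sum_f_R0 (fun j => (2 * (-1) ^ j)
      * (v * sin (a * v) * exp (- ((2 * INR j + 1) * PI * v)))) n)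
  (sum_f_R0 (fun j => (2 * (-1) ^ j) * (2 * a * ((2 * INR j + 1) * PI)
      / (a ^ 2 + ((2 * INR j + 1) * PI) ^ 2) ^ 2)))
  (fun n => 2 / INR (S n))).
- intros n x.
  apply (continuous_sum_f_R0 (fun j v => (2 * (-1) ^ j)
      * (v * sin (a * v) * exp (- ((2 * INR j + 1) * PI * v))))).
  intros k. apply (ex_derive_continuous (fun v => (2 * (-1) ^ k)
      * (v * sin (a * v) * exp (- ((2 * INR k + 1) * PI * v))))). now auto_derive.
(* The remainder carries [v * exp (- 2 (n + 1) PI v)], at most [1 / (n + 1)], while
   [1 / cosh (PI v)] supplies [2 * exp (- v)]. *)
- intros n v Hv.
  assert (Hn : 1 <= INR (S n)) by (rewrite S_INR; pose proof (pos_INR n); lra).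
  pose proof (cosh_pos (PI * v)) as Hch.
  assert (E : sin (a * v) / cosh (PI * v) * v - sum_f_R0 (fun j => (2 * (-1) ^ j)
      * (v * sin (a * v) * exp (- ((2 * INR j + 1) * PI * v)))) n
    = - (sin (a * v) * (-1) ^ n
       * (v * exp (- (2 * INR (S n) * PI * v))) * / cosh (PI * v))).
  { pose proof (sech_partial_geometric_sum (PI * v) n) as H.
    rewrite (sum_eq (fun j => 2 * (-1) ^ j * _)
      (fun j => ((-1) ^ j * exp (- ((2 * INR j + 1) * (PI * v)))) * (2 * (v * sin (a * v))))).
    2:{ intros i _. rewrite (Rmult_assoc (2 * INR i + 1)). ring. }
    rewrite <- scal_sum.
    replace (2 * INR (S n) * (PI * v)) with (2 * INR (S n) * PI * v) in H by ring.
    set (S0 := sum_f_R0 _ n) in *.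
    replace S0 with ((1 + (-1) ^ n * exp (- (2 * INR (S n) * PI * v))) / (2 * cosh (PI * v)))
      by (rewrite <- H; field; lra).
    field. lra. }
  rewrite E, Rabs_Ropp, !Rabs_mult, pow_1_abs, Rmult_1_r, Rabs_inv,
    (Rabs_pos_eq (cosh _)), (Rabs_pos_eq v), (Rabs_pos_eq (exp _))
    by (try (left; apply exp_pos); lra).
  replace (2 / INR (S n) * exp (- v)) with (1 * / INR (S n) * (2 * exp (- v)))
    by (field; lra).
  apply Rmult_le_compat.
  + apply Rmult_le_pos; [apply Rabs_pos|]. apply Rmult_le_pos; [lra|left; apply exp_pos].
  + left. now apply Rinv_0_lt_compat.
  + apply Rmult_le_compat; [apply Rabs_pos| |apply Rabs_le, SIN_bound|].
    * apply Rmult_le_pos; [lra|left; apply exp_pos].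
    * apply Rle_trans with (/ (2 * INR (S n) * PI)).
      -- apply id_mul_exp_opp_le. nra.
      -- apply Rinv_le_contravar; nra.
  + apply Rle_trans with (1 := Rinv_cosh_PI_le v Hv).
    apply Rmult_le_compat_l; [lra|]. apply exp_le. lra.
- apply is_lim_seq_div_S.
- intros n.
  refine (is_RInt_gen_sum_f_R0 (fun j v => (2 * (-1) ^ j)
      * (v * sin (a * v) * exp (- ((2 * INR j + 1) * PI * v)))) _ _ _ n _).
  intros j. apply (is_RInt_gen_scal (V := R_NormedModule)).
  apply is_RInt_gen_id_sin_exp. pose proof (pos_INR j). nra.
(* With [a = PI al] each term has [PI^2] above and [PI^4] below, which leaves the factor
   [2 / PI^2]. *)
- pose proof (sinh_cosh_partial_fractions (a / PI)) as H.
  replace (a / PI * (PI / 2)) with (a / 2) in H by (field; lra).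
  apply (is_lim_seq_scal_l _ (2 / PI ^ 2)) in H.
  pose proof (cosh_pos (a / 2)).
  simpl in H.
  replace (2 / (PI * (PI * 1)) * (PI * (PI * 1) / 8 * (sinh (a / 2) / (cosh (a / 2)
     * (cosh (a / 2) * 1))))) with (sinh (a / 2) / (4 * cosh (a / 2) ^ 2)) in H
     by (field; lra).
  apply is_lim_seq_ext with (2 := H). intros n.
  rewrite scal_sum. apply sum_eq. intros i _. pose proof (pos_INR i). field.
  repeat split; nra.
Qed.

(** * Remainder of the alternating beta series *)

(* [u] is the difference of the nonincreasing null sequences [u + w] and [w]. *)
Lemma alternating_Series_remainder (u w : nat -> R) :
  (forall k, w (S k) <= w k) ->
  (forall k, u (S k) + w (S k) <= u k + w k) ->
  (forall k, Rabs (u k) <= w k) ->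
  is_lim_seq w 0 ->
  forall n, Rabs (Series (fun k => (-1) ^ k * u k)
      - sum_f_R0 (fun k => (-1) ^ k * u k) (2 * n)) <= 3 * w (S (2 * n)).
Proof.
intros Dw Du Hu Lw n.
set (U := fun k => u k + w k).
assert (LU : is_lim_seq U 0).
{ replace (Finite 0) with (Finite (0 + 0)) by (f_equal; ring).
  apply is_lim_seq_plus'; [|exact Lw].
  apply is_lim_seq_abs_0.
  apply is_lim_seq_le_le with (u := fun _ => 0) (w := w);
    [|apply is_lim_seq_const|exact Lw].
  intros k. split; [apply Rabs_pos|apply Hu]. }
apply is_lim_seq_Reals in LU. pose proof (proj1 (is_lim_seq_Reals _ _) Lw) as Lw'.
destruct (alternated_series U Du LU) as [l1 H1].
destruct (alternated_series w Dw Lw') as [l2 H2].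
assert (E : forall N, sum_f_R0 (fun k => (-1) ^ k * u k) N
  = sum_f_R0 (tg_alt U) N - sum_f_R0 (tg_alt w) N).
{ intros N. rewrite <- minus_sum. apply sum_eq. intros i _. unfold tg_alt, U. ring. }
assert (HS : Series (fun k => (-1) ^ k * u k) = l1 - l2).
{ apply is_series_unique.
  change (is_lim_seq (sum_n (fun k => (-1) ^ k * u k)) (l1 - l2)).
  apply (is_lim_seq_ext (fun N => sum_f_R0 (tg_alt U) N - sum_f_R0 (tg_alt w) N)).
  - intros N. rewrite sum_n_Reals. symmetry. apply E.
  - apply is_lim_seq_minus'; now apply is_lim_seq_Reals. }
rewrite HS, E.
(* Each limit lies between the partial sums up to [2 n] and [2 n + 1], so the errors are at most [U]
   and [w] at [2 n + 1], and [U <= 2 w]. *)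
pose proof (alternated_series_ineq U l1 n Du LU H1) as B1.
pose proof (alternated_series_ineq w l2 n Dw Lw' H2) as B2.
rewrite tech5 in B1, B2.
unfold tg_alt at 2 in B1. unfold tg_alt at 2 in B2.
rewrite pow_1_odd in B1, B2.
pose proof (Hu (S (2 * n))) as H. apply Rabs_le_between in H.
unfold U in B1 at 2.
apply Rabs_le. lra.
Qed.

(** Written through [exp] and [ln] to match [Rcpow] and to be a value of [exp (- (t / 2))] at
    [t = ln (2 k + 1)], the variable in which monotonicity is proved. *)
Definition odd_inv_sqrt (k : nat) : R := exp (- (ln (2 * INR k + 1) / 2)).

Lemma is_lim_odd_inv_sqrt : is_lim_seq odd_inv_sqrt 0.
Proof.
apply (is_lim_comp_seq exp (fun k => - (ln (2 * INR k + 1) / 2)) m_infty 0).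
- apply is_lim_exp_m.
- exists 0%nat. discriminate.
- replace m_infty with (Rbar_opp p_infty) by reflexivity.
  apply -> is_lim_seq_opp.
  replace p_infty with (Rbar_mult p_infty (/ 2)).
  2:{ apply is_Rbar_mult_unique, is_Rbar_mult_p_infty_pos. simpl. lra. }
  apply is_lim_seq_scal_r.
  apply (is_lim_comp_seq ln (fun k => 2 * INR k + 1) p_infty p_infty).
  + apply is_lim_ln_p.
  + exists 0%nat. discriminate.
  + apply is_lim_seq_le_p_loc with INR; [|apply is_lim_seq_INR].
    exists 0%nat. intros k _. pose proof (pos_INR k). lra.
Qed.

Lemma ln_odd_incr (k : nat) : ln (2 * INR k + 1) <= ln (2 * INR (S k) + 1).
Proof.
rewrite S_INR. pose proof (pos_INR k). apply ln_le; lra.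
Qed.

(** The slope in [t] is [- exp (- t / 2)] times [1/2 + |v| - sin (t v) / 2 + v cos (t v)], and
    [1/2 + |v|] is just enough to keep the latter nonnegative. Hence the terms of the beta series
    become monotone after adding [(1 + 2 |v|) (2 k + 1)^(-1/2)]. *)
Lemma exp_sin_decreasing (v p q : R) : p <= q ->
  exp (- (q / 2)) * (1 + 2 * Rabs v - sin (q * v))
  <= exp (- (p / 2)) * (1 + 2 * Rabs v - sin (p * v)).
Proof.
intros Hpq.
destruct (MVT_gen (fun t => exp (- (t / 2)) * (1 + 2 * Rabs v - sin (t * v))) p q
  (fun t => - exp (- (t / 2)) * (1 / 2 + Rabs v - sin (t * v) / 2 + v * cos (t * v))))
  as [z [_ Ez]].
- intros t _. auto_derive; [trivial|]. unfold Rdiv. field.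
- intros t _. apply continuity_pt_filterlim.
  apply (ex_derive_continuous (fun t => exp (- (t / 2)) * (1 + 2 * Rabs v - sin (t * v)))).
  now auto_derive.
- pose proof (exp_pos (- (z / 2))) as He. pose proof (SIN_bound (z * v)) as Hs.
  assert (Hc : - Rabs v <= v * cos (z * v)).
  { pose proof (COS_bound (z * v)).
    apply Rle_trans with (- Rabs (v * cos (z * v))).
    - rewrite Rabs_mult. assert (Rabs (cos (z * v)) <= 1) by now apply Rabs_le.
      pose proof (Rabs_pos v). nra.
    - pose proof (Rle_abs (- (v * cos (z * v)))) as H1. rewrite Rabs_Ropp in H1. lra. }
  enough (0 <= exp (- (z / 2)) * (1 / 2 + Rabs v - sin (z * v) / 2 + v * cos (z * v)) * (q - p))
    by lra.
  apply Rmult_le_pos; [|lra]. apply Rmult_le_pos; lra.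
Qed.

(** * The beta function at [1/2 + i v] and the exchange of sum and integral *)

Lemma Im_Dirichlet_beta_half (v : R) :
  Im (Dirichlet_beta (1 / 2, v))
  = Series (fun k => (-1) ^ k * (- (odd_inv_sqrt k * sin (ln (2 * INR k + 1) * v)))).
Proof.
unfold Dirichlet_beta, CSeries. simpl Im.
apply Series_ext. intros k.
assert (Hp : Cpow (RtoC (-1)) k = RtoC ((-1) ^ k)) by (symmetry; apply RtoC_pow).
rewrite Hp. unfold Rcpow, Cexp, odd_inv_sqrt.
set (L := ln (2 * INR k + 1)).
unfold Cdiv, Cmult, Cinv, RtoC; simpl.
replace (1 / 2 * L - v * 0) with (L / 2) by field.
replace (1 / 2 * 0 + v * L) with (L * v) by field.
rewrite exp_Ropp. pose proof (exp_pos (L / 2)) as He.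
set (e := exp (L / 2)) in *. set (s := sin (L * v)). set (c := cos (L * v)).
assert (Hsc : s * s + c * c = 1) by apply (sin2_cos2 (L * v)).
replace (e * c * (e * c * 1) + e * s * (e * s * 1)) with (e * e)
  by (transitivity (e * e * (s * s + c * c)); [rewrite Hsc; ring|ring]).
field. lra.
Qed.

(** With [E^2 = 2 k + 1] the left side is [(E^2 - 1) / (2 (E^2 + 1)^2) = k / (4 (k + 1)^2)]; the
    split form separates the [ln 2] and [eta(2)] series. *)
Lemma odd_inv_sqrt_mul_sinh_sech (k : nat) :
  odd_inv_sqrt k * (sinh (ln (2 * INR k + 1) / 2) / (4 * cosh (ln (2 * INR k + 1) / 2) ^ 2))
  = (1 / INR (S k) - 1 / INR (S k) ^ 2) / 4.
Proof.
unfold odd_inv_sqrt, sinh, cosh. rewrite S_INR.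
pose proof (pos_INR k) as Hk.
set (E := exp (ln (2 * INR k + 1) / 2)).
assert (HE : 0 < E) by apply exp_pos.
assert (E2 : 2 * INR k + 1 = E * E).
{ unfold E. rewrite <- exp_plus.
  replace (ln (2 * INR k + 1) / 2 + ln (2 * INR k + 1) / 2) with (ln (2 * INR k + 1)) by field.
  rewrite exp_ln; lra. }
rewrite exp_Ropp. fold E.
replace (INR k) with ((E * E - 1) / 2) by lra.
field. repeat split; nra.
Qed.

Theorem mainTheorem7 :
  is_RInt_gen
    (fun v : R => Im (Dirichlet_beta (1 / 2, v)) / cosh (PI * v) * v)
    (at_point 0) (Rbar_locally p_infty)
    (PI ^ 2 / 48 - ln 2 / 4).
Proof.
(* Partial sums stop at [2 n], where the alternating remainder is bounded. In [48 = 3 * 2 * 8], 3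
   comes from that remainder, 2 from [1 / cosh (PI v)], and 8 from [(1 + 2 v) v <= 8 exp v]. *)
apply (is_RInt_gen_exp_dominated_lim _
  (fun n v => sum_f_R0 (fun k => (- ((-1) ^ k * odd_inv_sqrt k))
      * (sin (ln (2 * INR k + 1) * v) / cosh (PI * v) * v)) (2 * n))
  (fun n => sum_f_R0 (fun k => (- ((-1) ^ k * odd_inv_sqrt k))
      * (sinh (ln (2 * INR k + 1) / 2) / (4 * cosh (ln (2 * INR k + 1) / 2) ^ 2))) (2 * n))
  (fun n => 48 * odd_inv_sqrt (S (2 * n)))).
- intros n x.
  apply (continuous_sum_f_R0 (fun k v => (- ((-1) ^ k * odd_inv_sqrt k))
      * (sin (ln (2 * INR k + 1) * v) / cosh (PI * v) * v))).
  intros k. apply (continuous_scal_r (V := R_NormedModule)), continuous_sin_div_cosh.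
- intros n v Hv.
  pose proof (cosh_pos (PI * v)) as Hch.
  rewrite Im_Dirichlet_beta_half.
  set (u := fun k => - (odd_inv_sqrt k * sin (ln (2 * INR k + 1) * v))).
  rewrite (sum_eq _ (fun k => ((-1) ^ k * u k) * (v / cosh (PI * v))))
    by (intros i _; unfold u; field; lra).
  rewrite <- scal_sum.
  set (S0 := Series _). set (s0 := sum_f_R0 _ _).
  replace (S0 / cosh (PI * v) * v - v / cosh (PI * v) * s0)
    with ((S0 - s0) * (v * / cosh (PI * v))) by (field; lra).
  assert (Hw : forall k, 0 < odd_inv_sqrt k) by (intros; apply exp_pos).
  assert (HR : Rabs (S0 - s0) <= 3 * ((1 + 2 * Rabs v) * odd_inv_sqrt (S (2 * n)))).
  { apply (alternating_Series_remainder u (fun k => (1 + 2 * Rabs v) * odd_inv_sqrt k)).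
    - intros k. apply Rmult_le_compat_l; [pose proof (Rabs_pos v); lra|].
      apply exp_le. pose proof (ln_odd_incr k). lra.
    - intros k. pose proof (exp_sin_decreasing v _ _ (ln_odd_incr k)) as H.
      unfold u. fold (odd_inv_sqrt k) (odd_inv_sqrt (S k)) in H. lra.
    - intros k. unfold u. rewrite Rabs_Ropp, Rabs_mult, (Rabs_pos_eq (odd_inv_sqrt k))
        by (left; apply Hw).
      assert (Rabs (sin (ln (2 * INR k + 1) * v)) <= 1) by apply Rabs_le, SIN_bound.
      pose proof (Hw k). pose proof (Rabs_pos v). nra.
    - replace (Finite 0) with (Rbar_mult (1 + 2 * Rabs v) 0) by (simpl; f_equal; ring).
      apply is_lim_seq_scal_l, is_lim_odd_inv_sqrt. }
  rewrite (Rabs_pos_eq v) in HR by exact Hv.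
  rewrite Rabs_mult, (Rabs_pos_eq (v * _)).
  2:{ apply Rmult_le_pos; [exact Hv|left; now apply Rinv_0_lt_compat]. }
  pose proof (Rinv_cosh_PI_le v Hv) as Hc.
  specialize (Hw (S (2 * n))). set (w := odd_inv_sqrt (S (2 * n))) in *.
  (* Squaring [exp (v / 2) >= 1 + v / 2] gives [8 exp v >= 8 + 8 v + 2 v^2]. *)
  assert (Hexp : (1 + 2 * v) * v <= 8 * exp v).
  { replace (exp v) with (exp (v / 2) * exp (v / 2))
      by (rewrite <- exp_plus; f_equal; field).
    pose proof (exp_ineq1_le (v / 2)). nra. }
  apply Rle_trans with (3 * ((1 + 2 * v) * w) * (v * (2 * exp (- (2 * v))))).
  + apply Rmult_le_compat; [apply Rabs_pos| |exact HR|].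
    * apply Rmult_le_pos; [exact Hv|left; now apply Rinv_0_lt_compat].
    * now apply Rmult_le_compat_l.
  + replace (exp (- v)) with (exp v * exp (- (2 * v)))
      by (rewrite <- exp_plus; f_equal; ring).
    replace (3 * ((1 + 2 * v) * w) * (v * (2 * exp (- (2 * v)))))
      with ((1 + 2 * v) * v * (6 * w * exp (- (2 * v)))) by ring.
    replace (48 * w * (exp v * exp (- (2 * v))))
      with (8 * exp v * (6 * w * exp (- (2 * v)))) by ring.
    apply Rmult_le_compat_r; [|exact Hexp].
    apply Rmult_le_pos; [lra|left; apply exp_pos].
- replace (Finite 0) with (Rbar_mult 48 0) by (simpl; f_equal; ring).
  apply is_lim_seq_scal_l.
  apply (is_lim_seq_subseq odd_inv_sqrt); [|apply is_lim_odd_inv_sqrt].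
  apply eventually_subseq. intros n. lia.
- intros n.
  refine (is_RInt_gen_sum_f_R0 (fun k v => (- ((-1) ^ k * odd_inv_sqrt k))
      * (sin (ln (2 * INR k + 1) * v) / cosh (PI * v) * v)) _ _ _ (2 * n) _).
  intros k. apply (is_RInt_gen_scal (V := R_NormedModule)), is_RInt_gen_id_sin_sech.
- apply (is_lim_seq_subseq (sum_f_R0 (fun k => (- ((-1) ^ k * odd_inv_sqrt k))
      * (sinh (ln (2 * INR k + 1) / 2) / (4 * cosh (ln (2 * INR k + 1) / 2) ^ 2))))
      _ (fun n => (2 * n)%nat)).
  + apply eventually_subseq. intros n. lia.
  (* The minus sign from the imaginary part turns [1 / (k + 1) - 1 / (k + 1)^2] around, so the limit
     is [eta(2) - ln 2] over 4. *)
  + apply is_lim_seq_ext with (fun n => / 4 * (sum_f_R0 (fun k => (-1) ^ k / INR (S k) ^ 2) n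
       - sum_f_R0 (fun k => (-1) ^ k / INR (S k)) n)).
    * intros n. rewrite <- minus_sum, scal_sum. apply sum_eq. intros k _.
      transitivity (- (-1) ^ k * ((1 / INR (S k) - 1 / INR (S k) ^ 2) / 4)).
      -- unfold Rdiv. ring.
      -- rewrite <- odd_inv_sqrt_mul_sinh_sech. ring.
    * replace (PI ^ 2 / 48 - ln 2 / 4) with (/ 4 * (PI ^ 2 / 12 - ln 2)) by field.
      apply (is_lim_seq_scal_l _ (/ 4) (Finite (PI ^ 2 / 12 - ln 2))).
      apply is_lim_seq_minus'; [apply alternating_inverse_squares_lim
        |apply alternating_harmonic_lim].
Qed.
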